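(* Let $n\ge 2$, let $W\in\mathbb{R}^{n^2\times n^2}$ be symmetric, $c\in\mathbb{R}^{n^2}$, $d\in\mathbb{R}$, and let $E(X)=x^TWx+c^Tx+d$, where $x\in\mathbb{R}^{n^2}$ is the column stack of $X\in\mathbb{R}^{n\times n}$. With the optimization problems (DS+), (DS++), (Intersection-SDP), (P) and (SDP) and the notion of equivalence defined in the context: 1. (Intersection-SDP) is equivalent to (DS+). 2. (P) is equivalent to (DS++). 3. (SDP) can be obtained by adding additional linear constraints to (P): a pair $(X,Y)$ is feasible for (SDP) if and only if it is feasible for (P) and satisfies the additional linear constraints (L1), (L2), (L3) (the two problems having the same objective function).
   Context: Notation. For $X\in\mathbb{R}^{n\times n}$, $x=[X_{11},X_{21},\ldots,X_{nn}]^T\in\mathbb{R}^{n^2}$ is its column stack, and $\|X\|_F$ is the Frobenius norm. $\mathbf 1\in\mathbb{R}^n$ is the all-ones vector. $\mathrm{DS}$ is the set of doubly stochastic matrices: $X\in\mathbb{R}^{n\times n}$ with $X\mathbf 1=\mathbf 1$, $\mathbf 1^TX=\mathbf 1^T$, $X\ge 0$ entrywise. The linear equations $X\mathbf 1=\mathbf 1$, $\mathbf 1^TX=\mathbf 1^T$ are written as $Ax=b$ with $A\in\mathbb{R}^{2n\times n^2}$, $b\in\mathbb{R}^{2n}$. $F\in\mathbb{R}^{n^2\times (n-1)^2}$ is a matrix with $F^TF=I$ whose columns span the kernel of $A$. $\succeq$ is the positive semidefinite order. For $a\in\mathbb{R}$ let $E(X,a)=E(X)-a\|X\|_F^2+a\,n$.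 Let $\lambda_{\min}$ be the minimal eigenvalue of $W$ and $\bar\lambda_{\min}$ the minimal eigenvalue of $F^TWF$. Quadratic programs in $X$: (DS+): minimize $E(X,\lambda_{\min})$ over $X\in\mathrm{DS}$. (DS++): minimize $E(X,\bar\lambda_{\min})$ over $X\in\mathrm{DS}$. Lifted problems in $(X,Y)$ with $X\in\mathbb{R}^{n\times n}$ and $Y\in\mathbb{R}^{n^2\times n^2}$ symmetric, all with the objective, to be minimized, $E(X,Y)=\mathrm{tr}(WY)+c^Tx+d$. The entry of $Y$ whose row index is the position of $X_{qr}$ in $x$ and whose column index is the position of $X_{st}$ in $x$ is denoted $Y_{qrst}$. (Intersection-SDP): constraints $\mathrm{tr}\,Y=n$, $X\in\mathrm{DS}$, $Y\succeq xx^T$. (P): constraints $\mathrm{tr}\,Y=n$, $X\ge 0$, $Ax=b$, $AY=bx^T$, $Y\succeq xx^T$. (SDP): constraints $\mathrm{tr}\,Y=n$, $x\ge 0$, $Ax=b$, $Y\succeq xx^T$, together with (L1) $Y\ge 0$ entrywise; (L2) $\sum_{q,r,s,t}Y_{qrst}=n^2$; (L3) for all $q,r,s,t$: $Y_{qrst}\le 0$ if $q=s$ and $r\neq t$; $Y_{qrst}\le 0$ if $r=t$ and $q\neq s$; $Y_{qrst}\le\min\{X_{qr},X_{st}\}$ otherwise. Equivalence. A lifted problem in $(X,Y)$ is equivalent to a quadratic program in $X$ if (a) for every minimizer $X$ of the quadratic program there is $Y$ such that $(X,Y)$ is feasible for the lifted problem and the objective values are equal; and (b) for every minimizer $(X,Y)$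 of the lifted problem, $X$ is feasible for the quadratic program and the objective values are equal. (In particular the two optimal values coincide.) *)

(* Defs.v *)
From HB Require Import structures.
From mathcomp Require Import all_boot all_order all_algebra.
From mathcomp Require Import reals.

Set Implicit Arguments.
Unset Strict Implicit.
Unset Printing Implicit Defensive.

Import Order.TTheory GRing.Theory Num.Theory.
Local Open Scope ring_scope.

(* [mxvec] is row-major, hence the transpose.  The dimension n^2 is written
   [n * n], as in the type of [mxvec]. *)
Definition colstack (R : realType) (n : nat) (X : 'M[R]_n) : 'cV[R]_(n * n) :=
  (mxvec X^T)^T.

(* Position of the entry X_qr in [colstack X]; see [colstackE]. *)
Definition cpos (n : nat) (q r : 'I_n) : 'I_(n * n) := mxvec_index r q.

Lemma colstackE (R : realType) (n : nat) (X : 'M[R]_n) (q r : 'I_n) :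
  colstack X (cpos q r) 0 = X q r.
Proof. by rewrite /colstack /cpos mxE mxvecE mxE. Qed.

Definition ones (R : realType) (m : nat) : 'cV[R]_m := const_mx 1.
Arguments ones {R} m.

Definition mx_nonneg (R : realType) (m p : nat) (M : 'M[R]_(m, p)) : Prop :=
  forall i j, 0 <= M i j.

Definition frobenius_norm (R : realType) (m p : nat) (M : 'M[R]_(m, p)) : R :=
  Num.sqrt (\sum_i \sum_j M i j ^+ 2).

Definition psd (R : realType) (m : nat) (M : 'M[R]_m) : Prop :=
  M^T = M /\ forall v : 'cV[R]_m, 0 <= (v^T *m M *m v) 0 0.

Definition psd_le (R : realType) (m : nat) (M N : 'M[R]_m) : Prop :=
  psd (N - M).

Definition is_min_eigenvalue (R : realType) (m : nat) (M : 'M[R]_m) (a : R)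
  : Prop :=
  eigenvalue M a /\ forall b, eigenvalue M b -> a <= b.

Definition doubly_stochastic (R : realType) (n : nat) (X : 'M[R]_n) : Prop :=
  [/\ X *m ones n = ones n,
      (ones n)^T *m X = (ones n)^T
    & mx_nonneg X].

(* The linear system A x = b: the first n rows of A are the column stacks of
   the indicators of the rows of X, the last n those of the columns of X. *)
Definition dsA (R : realType) (n : nat) : 'M[R]_(n + n, n * n) :=
  col_mx (\matrix_(i < n) (colstack (\matrix_(p, q) (p == i)%:R))^T)
         (\matrix_(j < n) (colstack (\matrix_(p, q) (q == j)%:R))^T).
Arguments dsA {R} n.

Definition dsb (R : realType) (n : nat) : 'cV[R]_(n + n) := ones (n + n).
Arguments dsb {R} n.

Lemma colstack_dot (R : realType) (n : nat) (M X : 'M[R]_n) :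
  ((colstack M)^T *m colstack X) 0 0 = \sum_i \sum_j M i j * X i j.
Proof.
rewrite [RHS]exchange_big pair_bigA mxE /=.
rewrite (reindex _ (curry_mxvec_bij _ _)) /=.
apply: eq_bigr => -[j i] _ /=.
by rewrite mxE -[mxvec_index j i]/(cpos i j) !colstackE.
Qed.

Lemma dsAbE (R : realType) (n : nat) (X : 'M[R]_n) :
  dsA n *m colstack X = dsb n <->
  X *m ones n = ones n /\ (ones n)^T *m X = (ones n)^T.
Proof.
have rowE i : (dsA n *m colstack X) (lshift n i) 0 = (X *m ones n) i 0.
  have -> : (dsA n *m colstack X) (lshift n i) 0 =
            (row (lshift n i) (dsA n) *m colstack X) 0 0.
    by rewrite -row_mul [in RHS]mxE.
  rewrite rowKu rowK colstack_dot mxE (bigD1 i) //= [X in _ + X]big1.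
    by rewrite addr0; apply: eq_bigr => j _; rewrite !mxE eqxx mul1r mulr1.
  by move=> k /negPf ki; apply: big1 => j _; rewrite mxE ki mul0r.
have colE j : (dsA n *m colstack X) (rshift n j) 0 = ((ones n)^T *m X) 0 j.
  have -> : (dsA n *m colstack X) (rshift n j) 0 =
            (row (rshift n j) (dsA n) *m colstack X) 0 0.
    by rewrite -row_mul [in RHS]mxE.
  rewrite rowKd rowK colstack_dot mxE; apply: eq_bigr => i _.
  rewrite (bigD1 j) //= [X in _ + X]big1 ?addr0 ?mxE ?eqxx //.
  by move=> k /negPf kj; rewrite mxE kj mul0r.
split=> [h | [h1 h2]].
  split; apply/matrixP => i j; rewrite ?[j]ord1 ?[i]ord1.
    by rewrite -rowE h !mxE.
  by rewrite -colE h !mxE.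
apply/matrixP => i j; rewrite [j]ord1; case: (split_ordP i) => k ->.
  by rewrite rowE h1 !mxE.
by rewrite colE h2 !mxE.
Qed.

Definition columns_span_ker (R : realType) (l m p : nat)
    (F : 'M[R]_(m, p)) (A : 'M[R]_(l, m)) : Prop :=
  forall v : 'cV[R]_m, A *m v = 0 <-> exists w : 'cV[R]_p, v = F *m w.

Record program (R : realType) (T : Type) := Program {
  feasible : T -> Prop;
  objective : T -> R
}.

Definition minimizer (R : realType) (T : Type) (Q : program R T) (t : T)
  : Prop :=
  feasible Q t /\ forall u, feasible Q u -> objective Q t <= objective Q u.

Definition lifted_equiv (R : realType) (n : nat)
    (L : program R ('M[R]_n * 'M[R]_(n * n))) (Q : program R 'M[R]_n) : Prop :=
  (forall X, minimizer Q X ->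
     exists Y, feasible L (X, Y) /\ objective L (X, Y) = objective Q X) /\
  (forall X Y, minimizer L (X, Y) ->
     feasible Q X /\ objective Q X = objective L (X, Y)).

Definition energy (R : realType) (n : nat)
    (W : 'M[R]_(n * n)) (c : 'cV[R]_(n * n)) (d : R) (X : 'M[R]_n) : R :=
  let x := colstack X in (x^T *m W *m x) 0 0 + (c^T *m x) 0 0 + d.

Definition shifted_energy (R : realType) (n : nat)
    (W : 'M[R]_(n * n)) (c : 'cV[R]_(n * n)) (d : R) (X : 'M[R]_n) (a : R)
  : R :=
  energy W c d X - a * frobenius_norm X ^+ 2 + a * n%:R.

Definition lifted_energy (R : realType) (n : nat)
    (W : 'M[R]_(n * n)) (c : 'cV[R]_(n * n)) (d : R)
    (XY : 'M[R]_n * 'M[R]_(n * n)) : R :=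
  \tr (W *m XY.2) + (c^T *m colstack XY.1) 0 0 + d.

(* (DS+) is the case where a is the minimal eigenvalue of W, (DS++) the case
   where a is the minimal eigenvalue of F^T W F. *)
Definition DS_program (R : realType) (n : nat)
    (W : 'M[R]_(n * n)) (c : 'cV[R]_(n * n)) (d : R) (a : R)
  : program R 'M[R]_n :=
  {| feasible := @doubly_stochastic R n;
     objective := fun X => shifted_energy W c d X a |}.

Definition Intersection_SDP (R : realType) (n : nat)
    (W : 'M[R]_(n * n)) (c : 'cV[R]_(n * n)) (d : R)
  : program R ('M[R]_n * 'M[R]_(n * n)) :=
  {| feasible := fun '(X, Y) =>
       let x := colstack X in
       [/\ Y^T = Y, \tr Y = n%:R, doubly_stochastic X & psd_le (x *m x^T) Y];
     objective := lifted_energy W c d |}.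

Definition P_program (R : realType) (n : nat)
    (W : 'M[R]_(n * n)) (c : 'cV[R]_(n * n)) (d : R)
  : program R ('M[R]_n * 'M[R]_(n * n)) :=
  {| feasible := fun '(X, Y) =>
       let x := colstack X in
       [/\ Y^T = Y, \tr Y = n%:R & mx_nonneg X] /\
       [/\ dsA n *m x = dsb n, dsA n *m Y = dsb n *m x^T
         & psd_le (x *m x^T) Y];
     objective := lifted_energy W c d |}.

Definition L1 (R : realType) (n : nat) (Y : 'M[R]_(n * n)) : Prop :=
  mx_nonneg Y.

Definition L2 (R : realType) (n : nat) (Y : 'M[R]_(n * n)) : Prop :=
  \sum_(q < n) \sum_(r < n) \sum_(s < n) \sum_(t < n)
    Y (cpos q r) (cpos s t) = n%:R ^+ 2.

Definition L3 (R : realType) (n : nat) (X : 'M[R]_n) (Y : 'M[R]_(n * n))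
  : Prop :=
  forall q r s t : 'I_n,
    Y (cpos q r) (cpos s t) <=
      if (q == s) && (r != t) then 0
      else if (r == t) && (q != s) then 0
      else Num.min (X q r) (X s t).

Definition SDP_program (R : realType) (n : nat)
    (W : 'M[R]_(n * n)) (c : 'cV[R]_(n * n)) (d : R)
  : program R ('M[R]_n * 'M[R]_(n * n)) :=
  {| feasible := fun '(X, Y) =>
       let x := colstack X in
       [/\ Y^T = Y, \tr Y = n%:R, mx_nonneg x, dsA n *m x = dsb n
         & psd_le (x *m x^T) Y] /\
       [/\ L1 Y, L2 Y & L3 X Y];
     objective := lifted_energy W c d |}.

(* Main.v *)
(* Put Z = Y - xx^T, which is positive semidefinite.  Since tr Y = n, the lifted
   objective exceeds E(X, a) by tr(WZ) - a tr Z.  For a the minimal eigenvalue of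
   W this gap is nonnegative, by diagonalising W; it vanishes when Z is a
   multiple of uu^T with u a unit eigenvector, the multiple n - |X|_F^2 being
   nonnegative for doubly stochastic X.  In (P) the constraint AY = bx^T says
   AZ = 0, hence Z = F (F^T Z F) F^T and the same argument applies to F^T W F.
   For (SDP), let a_i^T be a row of A: by (L3) the off-diagonal terms of
   a_i^T Y a_i are nonpositive and the diagonal ones are bounded by entries of X,
   so a_i^T Y a_i <= a_i^T x = 1, that is a_i^T Z a_i <= 0; as Z is positive
   semidefinite this forces Z a_i = 0. *)
Require Import Defs.
From mathcomp Require Import all_boot all_order all_algebra.
From mathcomp Require Import reals complex ring.

Set Implicit Arguments.
Unset Strict Implicit.
Unset Printing Implicit Defensive.

Import Order.TTheory GRing.Theory Num.Theory.
Local Open Scope ring_scope.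
Local Open Scope sesquilinear_scope.

(** * Spectral bounds for positive semidefinite matrices *)

(** The diagonalisation used below is unitary, hence complex. For [z = a + ib] the symmetry of [Z]
    cancels the cross terms, and what remains is the sum of the real forms at [a] and [b]. *)
Lemma psd_complex_ge0 (R : realType) (m : nat) (Z : 'M[R]_m) (z : 'rV[R[i]]_m) :
  psd Z -> 0 <= (z *m map_mx (real_complex R) Z *m z^t*) 0 0.
Proof.
move=> [Zsym Zpos]; set Zc := map_mx _ Z.
pose a := \row_j complex.Re (z 0 j); pose b := \row_j complex.Im (z 0 j).
pose ac := map_mx (real_complex R) a; pose bc := map_mx (real_complex R) b.
pose I : R[i] := (0 +i* 1)%C.
have zE : z = ac + I *: bc.
  by apply/rowP => j; rewrite !mxE; case: (z 0 j) => u v; simpc.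
have zsE : z^t* = ac^T - I *: bc^T.
  apply/matrixP => j k; rewrite ord1 !mxE; case: (z 0 j) => u v.
  by rewrite [LHS]/=; simpc.
have ge0 (v : 'rV[R]_m) : 0 <= (v *m Z *m v^T) 0 0.
  by have := Zpos v^T; rewrite trmxK.
have cross : ac *m Zc *m bc^T = bc *m Zc *m ac^T.
  rewrite !map_trmx -!map_mxM; congr map_mx.
  transitivity (a *m Z *m b^T)^T; last by rewrite !trmx_mul trmxK Zsym mulmxA.
  by apply/matrixP => i j; rewrite !ord1 [RHS]mxE.
have -> : z *m Zc *m z^t* = ac *m Zc *m ac^T + bc *m Zc *m bc^T.
  rewrite zsE zE !mulmxDl !mulmxBr -!scalemxAl -!scalemxAr cross scalerA.
  have -> : I * I = -1 by rewrite /I; simpc.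
  by rewrite scaleN1r opprK addrA subrK.
rewrite !map_trmx -!map_mxM mxE addr_ge0 // [X in 0 <= X]mxE.
  by rewrite ler0c.
by rewrite ler0c.
Qed.

Lemma mxtrace_diag_mul (K : pzSemiRingType) (m : nat) (e : 'rV[K]_m)
    (B : 'M[K]_m) :
  \tr (diag_mx e *m B) = \sum_i e 0 i * B i i.
Proof. by apply: eq_bigr => i _; rewrite mul_diag_mx mxE. Qed.

(** In an eigenbasis of [M] the two traces are the sums of [D 0 i * B i i] and of [B i i], where
    every [B i i] is nonnegative and every [D 0 i] is an eigenvalue of [M]. *)
Lemma min_eigenvalue_trace_le (R : realType) (m : nat) (M Z : 'M[R]_m) (a : R) :
  M^T = M -> is_min_eigenvalue M a -> psd Z -> a * \tr Z <= \tr (M *m Z).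
Proof.
move=> Msym [_ amin] Zpsd.
pose Mc := map_mx (real_complex R) M; pose Zc := map_mx (real_complex R) Z.
have Mherm : Mc \is hermsymmx.
  apply: realsym_hermsym.
    apply/is_hermitianmxP.
    by rewrite expr0 scale1r map_mx_id // /Mc map_trmx Msym.
  by apply/mxOverP => i j; rewrite mxE complex_real.
have Mnormal := hermitian_normalmx Mherm.
have Dreal := hermitian_spectral_diag_real Mherm.
have Puni := spectral_unitarymx Mc.
have invP := invmx_unitary Puni.
have Punit := spectral_unit Mc.
have ME := orthomx_spectralP Mnormal.
move: (spectralmx Mc) (spectral_diag Mc) Dreal invP Punit ME.
move=> P D Dreal invP Punit ME.
pose B := P *m Zc *m P^t*.
have trM : (\tr (M *m Z))%:C%C = \sum_i D 0 i * B i i.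
  rewrite -mxtrace_diag_mul -trace_map_mx map_mxM -/Mc -/Zc ME.
  by rewrite /B -invP -!mulmxA [LHS]mxtrace_mulC -!mulmxA.
have trZ : (\tr Z)%:C%C = \sum_i B i i.
  rewrite -[RHS]/(\tr B) /B mxtrace_mulC mulmxA -invP mulVmx //.
  by rewrite mul1mx trace_map_mx.
rewrite -lecR trM rmorphM /= trZ mulr_sumr; apply: ler_sum => i _.
apply: ler_wpM2r.
  have := psd_complex_ge0 (row i P) Zpsd.
  have -> // : (row i P *m Zc *m (row i P)^t*) 0 0 = B i i.
  rewrite -row_mul mxE [RHS]mxE; apply: eq_bigr => k _.
  by congr (_ * _); rewrite !mxE.
have /complex_realP [d dE] := mxOverP Dreal 0 i.
rewrite dE lecR; apply: amin.
(* Row [i] of [P] is a left eigenvector of [Mc] for [d], nonzero because [P] is invertible; as [d]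
   is real, it is an eigenvalue of [M] itself. *)
rewrite -(eigenvalue_map (real_complex R)) -/Mc; apply/eigenvalueP.
exists (row i P).
  rewrite -row_mul ME mulmxA mulmxA mulmxV // mul1mx.
  by apply/rowP => j; rewrite mxE mul_diag_mx !mxE dE.
apply: contraTneq Punit => Pi0; rewrite -row_free_unit; apply/negP.
by move=> /row_freeP [Q PQ]; have /rowP/(_ i) := row_mul i P Q;
   rewrite PQ Pi0 mul0mx !mxE eqxx => /eqP; rewrite oner_eq0.
Qed.

(** [eigenvalue] provides a row eigenvector; symmetry makes its transpose a column eigenvector,
    which is then normalised. *)
Lemma eigenvalue_unit_vector (R : realType) (m : nat) (M : 'M[R]_m) (a : R) :
  M^T = M -> eigenvalue M a ->
  exists w : 'cV[R]_m, \tr (w *m w^T) = 1 /\ \tr (M *m (w *m w^T)) = a.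
Proof.
move=> Msym /eigenvalueP [v vM v0].
pose s := \tr (v^T *m v).
have sE : s = \sum_i v 0 i ^+ 2.
  rewrite /s mxtrace_mulC /mxtrace big_ord1 mxE.
  by apply: eq_bigr => i _; rewrite mxE expr2.
have s_gt0 : 0 < s.
  rewrite lt_def sE sumr_ge0 ?andbT => [|i _]; last exact: sqr_ge0.
  apply: contra v0 => /eqP s0; apply/eqP/rowP => i; rewrite mxE; apply/eqP.
  rewrite -sqrf_eq0; apply/eqP.
  by apply: (psumr_eq0P _ s0) => // j _; apply: sqr_ge0.
have k2 : (Num.sqrt s)^-1 ^+ 2 * s = 1.
  by rewrite exprVn sqr_sqrtr ?ltW // mulVf // gt_eqF.
exists ((Num.sqrt s)^-1 *: v^T).
have -> : (Num.sqrt s)^-1 *: v^T *m ((Num.sqrt s)^-1 *: v^T)^T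
        = (Num.sqrt s)^-1 ^+ 2 *: (v^T *m v).
  by rewrite linearZ /= trmxK -scalemxAl -scalemxAr scalerA expr2.
have Mv : M *m v^T = a *: v^T by rewrite -[in LHS]Msym -trmx_mul vM linearZ.
rewrite -scalemxAr mulmxA Mv -scalemxAl !mxtraceZ -/s; split=> //.
by rewrite mulrCA k2 mulr1.
Qed.

(** Moving from [v] in the direction [w = Z *m v] changes the form by [2 * t * s + t ^+ 2 * k] with
    [s] the squared norm of [w]. Nonnegativity for all [t] leaves no room for the linear term. *)
Lemma psd_form_eq0 (R : realType) (m : nat) (Z : 'M[R]_m) (v : 'cV[R]_m) :
  psd Z -> (v^T *m Z *m v) 0 0 = 0 -> Z *m v = 0.
Proof.
move=> [Zsym Zpos] vZv; pose w := Z *m v.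
pose k := (w^T *m Z *m w) 0 0; pose s := (w^T *m w) 0 0.
have k_ge0 : 0 <= k by apply: Zpos.
have vZv0 : v^T *m Z *m v = 0 by apply/matrixP => i j; rewrite !ord1 vZv mxE.
have vZ : v^T *m Z = w^T by rewrite /w trmx_mul Zsym.
have quad t : 0 <= 2 * t * s + t ^+ 2 * k.
  have := Zpos (v + t *: w).
  have -> : (v + t *: w)^T = v^T + t *: w^T by rewrite linearD linearZ.
  rewrite !mulmxDl !mulmxDr -!scalemxAl -!scalemxAr -[w^T *m Z *m v]mulmxA -/w.
  rewrite vZv0 vZ add0r /s /k; move: (w^T *m w) (w^T *m Z *m w) => S K.
  rewrite !mxE; congr (0 <= _); ring.
have s0 : s = 0.
  have k1 : 0 < k + 1 by rewrite ltr_pwDr.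
  (* The vertex of the parabola is at [- s / k]; dividing by [k + 1] also covers [k = 0] and still
     gives a negative value unless [s = 0]. *)
  have := quad (- (s / (k + 1))).
  have -> : 2 * - (s / (k + 1)) * s + (- (s / (k + 1))) ^+ 2 * k
          = - ((s / (k + 1)) ^+ 2 * (k + 2)) by field; rewrite gt_eqF.
  rewrite oppr_ge0 => h.
  have k2 : 0 < k + 2 by rewrite ltr_pwDr.
  move: h; rewrite pmulr_lle0 // => h.
  have /eqP : (s / (k + 1)) ^+ 2 = 0 by apply/eqP; rewrite eq_le h sqr_ge0.
  by rewrite sqrf_eq0 mulf_eq0 invr_eq0 (gt_eqF k1) orbF => /eqP.
have sE : s = \sum_i w i 0 ^+ 2.
  by rewrite /s mxE; apply: eq_bigr => i _; rewrite mxE expr2.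
rewrite sE in s0; rewrite -/w; apply/colP => i; rewrite [RHS]mxE; apply/eqP.
rewrite -sqrf_eq0; apply/eqP.
by apply: (psumr_eq0P _ s0) => // j _; apply: sqr_ge0.
Qed.

(** * Comparison of lifted problems with quadratic programs *)

(** Over the [X] of a lifted minimizer, the lift of equal value cannot beat the minimizer, and the
    lower bound gives the other inequality. *)
Lemma lifted_equivI (R : realType) (n : nat)
    (L : program R ('M[R]_n * 'M[R]_(n * n))) (Q : program R 'M[R]_n) :
  (forall X Y, feasible L (X, Y) ->
     feasible Q X /\ objective Q X <= objective L (X, Y)) ->
  (forall X, feasible Q X ->
     exists Y, feasible L (X, Y) /\ objective L (X, Y) = objective Q X) ->
  lifted_equiv L Q.
Proof.
move=> relax attain; split=> [X [/attain //] | X Y [XY_feas XY_min]].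
have [X_feas XleXY] := relax _ _ XY_feas; split=> //.
have [Y' [XY'_feas XY'E]] := attain _ X_feas.
by apply/eqP; rewrite eq_le XleXY -XY'E XY_min.
Qed.

Lemma frobenius_normE (R : realType) (n : nat) (X : 'M[R]_n) :
  frobenius_norm X ^+ 2 = \tr (colstack X *m (colstack X)^T).
Proof.
rewrite mxtrace_mulC /mxtrace big_ord1 colstack_dot sqr_sqrtr.
  by apply: eq_bigr => i _; apply: eq_bigr => j _; rewrite expr2.
by apply: sumr_ge0 => i _; apply: sumr_ge0 => j _; apply: sqr_ge0.
Qed.

Lemma lifted_energy_gap (R : realType) (n : nat) (W : 'M[R]_(n * n))
    (c : 'cV[R]_(n * n)) (d a : R) (X : 'M[R]_n) (Y : 'M[R]_(n * n)) :
  let Z := Y - colstack X *m (colstack X)^T in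
  \tr Y = n%:R ->
  lifted_energy W c d (X, Y) =
  shifted_energy W c d X a + (\tr (W *m Z) - a * \tr Z).
Proof.
move=> Z trY; rewrite /lifted_energy /shifted_energy /energy /=.
have -> : ((colstack X)^T *m W *m colstack X) 0 0
        = \tr (W *m (colstack X *m (colstack X)^T)).
  by rewrite mulmxA [RHS]mxtrace_mulC mulmxA /mxtrace big_ord1.
have trB (A B : 'M[R]_(n * n)) : \tr (A - B) = \tr A - \tr B by exact: raddfB.
by rewrite frobenius_normE /Z mulmxBr !trB trY; ring.
Qed.

(** Entries lie in [0, 1], so each square is at most the entry, and the entries sum to [n]. *)
Lemma doubly_stochastic_frobenius_le (R : realType) (n : nat) (X : 'M[R]_n) :
  doubly_stochastic X -> frobenius_norm X ^+ 2 <= n%:R.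
Proof.
move=> [rowX _ X0]; rewrite sqr_sqrtr; last first.
  by apply: sumr_ge0 => i _; apply: sumr_ge0 => j _; apply: sqr_ge0.
have rowsum i : \sum_j X i j = 1.
  have /matrixP/(_ i 0) := rowX; rewrite !mxE => <-.
  by apply: eq_bigr => j _; rewrite mxE mulr1.
rewrite -[n in leRHS]card_ord -sumr_const; apply: ler_sum => i _.
rewrite -(rowsum i); apply: ler_sum => j _; rewrite expr2 ler_piMr //.
by rewrite -(rowsum i) (bigD1 j) //= lerDl sumr_ge0.
Qed.

Lemma psd_rank1 (R : realType) (m : nat) (u : 'cV[R]_m) (k : R) :
  0 <= k -> psd (k *: (u *m u^T)).
Proof.
move=> k0; split=> [|v]; first by rewrite linearZ /= trmx_mul trmxK.
have -> : v^T *m (k *: (u *m u^T)) *m v = k *: (v^T *m u *m (v^T *m u)^T).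
  by rewrite -scalemxAr -scalemxAl trmx_mul trmxK !mulmxA.
by move: (v^T *m u) => w; rewrite !mxE big_ord1 mxE mulr_ge0 // -expr2 sqr_ge0.
Qed.

(** The coefficient of [u *m u^T] is what [x *m x^T] lacks to reach trace [n]. The gap is this
    coefficient times [a - a]. *)
Lemma rank1_lift (R : realType) (n : nat) (W : 'M[R]_(n * n))
    (c : 'cV[R]_(n * n)) (d a : R) (X : 'M[R]_n) (u : 'cV[R]_(n * n)) :
  doubly_stochastic X -> \tr (u *m u^T) = 1 -> \tr (W *m (u *m u^T)) = a ->
  let x := colstack X in
  let Y := x *m x^T + (n%:R - frobenius_norm X ^+ 2) *: (u *m u^T) in
  [/\ Y^T = Y, \tr Y = n%:R, psd_le (x *m x^T) Y
    & lifted_energy W c d (X, Y) = shifted_energy W c d X a].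
Proof.
move=> Xds u1 Wu x Y.
have ZE : Y - x *m x^T = (n%:R - frobenius_norm X ^+ 2) *: (u *m u^T).
  by rewrite addrC addKr.
have Zpsd : psd (Y - x *m x^T).
  by rewrite ZE; apply: psd_rank1;
     rewrite subr_ge0 doubly_stochastic_frobenius_le.
have trY : \tr Y = n%:R.
  by rewrite linearD /= mxtraceZ u1 mulr1 frobenius_normE addrC subrK.
split=> //; first by rewrite /Y linearD linearZ /= !trmx_mul !trmxK.
rewrite (lifted_energy_gap _ _ _ a) // -/x ZE.
by rewrite -scalemxAr !mxtraceZ u1 Wu mulr1 mulrC subrr addr0.
Qed.

(** * From (L3) to [A Y = b x^T] *)

Lemma quad_form_le (R : realType) (m : nat) (a : 'rV[R]_m) (x : 'cV[R]_m)
    (Y : 'M[R]_m) :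
  (forall k, a 0 k * Y k k * a 0 k <= a 0 k * x k 0) ->
  (forall k l, k != l -> a 0 k * Y k l * a 0 l <= 0) ->
  (a *m Y *m a^T) 0 0 <= (a *m x) 0 0.
Proof.
move=> diag_le offdiag_le.
have -> : (a *m Y *m a^T) 0 0 = \sum_l \sum_k a 0 k * Y k l * a 0 l.
  rewrite mxE; apply: eq_bigr => l _; rewrite mxE mulr_suml.
  by apply: eq_bigr => k _; rewrite mxE.
rewrite mxE; apply: ler_sum => l _; rewrite (bigD1 l) //= -[leRHS]addr0.
by apply: lerD => //; apply: sumr_le0 => k /offdiag_le.
Qed.

Lemma dsA_lshiftE (R : realType) (n : nat) (i q r : 'I_n) :
  dsA n (lshift n i) (cpos q r) = (q == i)%:R :> R.
Proof. by rewrite col_mxEu 2!mxE colstackE mxE. Qed.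

Lemma dsA_rshiftE (R : realType) (n : nat) (j q r : 'I_n) :
  dsA n (rshift n j) (cpos q r) = (r == j)%:R :> R.
Proof. by rewrite col_mxEd 2!mxE colstackE mxE. Qed.

Lemma L3_dsA_quad_form_le (R : realType) (n : nat) (X : 'M[R]_n)
    (Y : 'M[R]_(n * n)) (i : 'I_(n + n)) :
  L3 X Y ->
  (row i (dsA n) *m Y *m (row i (dsA n))^T) 0 0
    <= (row i (dsA n) *m colstack X) 0 0.
Proof.
move=> Y3; have aE k : row i (dsA n) 0 k = dsA n i k :> R by rewrite mxE.
apply: quad_form_le => [k|k l]; rewrite !aE.
  case/mxvec_indexP: k => r q; rewrite -/(cpos q r) colstackE.
  have := Y3 q r q r; rewrite !eqxx /= minxx => Yle.
  by case: (split_ordP i) => j ->; rewrite ?dsA_lshiftE ?dsA_rshiftE;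
     case: (_ == j); rewrite ?mul1r ?mulr1 ?mul0r.
case/mxvec_indexP: k => r q; case/mxvec_indexP: l => t s.
rewrite -/(cpos q r) -/(cpos s t) => neq.
have := Y3 q r s t; move: neq.
case: (split_ordP i) => j ->; rewrite ?dsA_lshiftE ?dsA_rshiftE.
  (* Both positions lie in row [j]; being distinct, they differ in column, so the first case of (L3)
     applies. *)
  case: (eqVneq q j) => [->|_]; last by rewrite !mul0r.
  case: (eqVneq s j) => [->|_]; last by rewrite mulr0.
  rewrite mul1r mulr1; case: (eqVneq r t) => [->|//].
  by rewrite eqxx.
(* Both positions lie in column [j], which rules out the first case of (L3) and leads to the
   second. *)
case: (eqVneq r j) => [->|_]; last by rewrite !mul0r.
case: (eqVneq t j) => [->|_]; last by rewrite mulr0.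
rewrite mul1r mulr1 andbF /=; case: (eqVneq q s) => [->|//].
by rewrite eqxx.
Qed.

Lemma L3_dsA_mul (R : realType) (n : nat) (X : 'M[R]_n) (Y : 'M[R]_(n * n)) :
  let x := colstack X in
  dsA n *m x = dsb n -> psd_le (x *m x^T) Y -> L3 X Y ->
  dsA n *m Y = dsb n *m x^T.
Proof.
(* With [b = A x] the claim reads [A Z = 0], proved row by row. *)
move=> x AX XY Y3; rewrite -AX -mulmxA; apply/eqP; rewrite -subr_eq0 -mulmxBr.
apply/eqP/row_matrixP => i; rewrite row0 row_mul.
have [Zsym Zpos] := XY; set Z := Y - _ in Zsym Zpos *.
pose a : 'rV[R]_(n * n) := row i (dsA n).
have ax : a *m x = 1%:M.
  by rewrite -row_mul AX; apply/matrixP => j k; rewrite !ord1 !mxE.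
have aZa : (a *m Z *m a^T) 0 0 = 0.
  apply/eqP; rewrite eq_le; apply/andP; split; last first.
    by have := Zpos a^T; rewrite trmxK.
  have := L3_dsA_quad_form_le i Y3; rewrite -/a -/x ax [in leRHS]mxE eqxx.
  have xa : x^T *m a^T = 1%:M by rewrite -trmx_mul ax trmx1.
  have -> : a *m Z *m a^T = a *m Y *m a^T - 1%:M.
    rewrite mulmxBr mulmxBl; congr (_ - _).
    by rewrite mulmxA ax mul1mx xa.
  by move: (a *m Y *m a^T) => S; rewrite !mxE eqxx subr_le0.
rewrite -/a -[LHS]trmxK trmx_mul Zsym psd_form_eq0 ?trmx0 //.
by rewrite trmxK.
Qed.

Theorem lemma2 (R : realType) (n : nat) (hn : (2 <= n)%N)
    (W : 'M[R]_(n * n)) (hW : W^T = W) (c : 'cV[R]_(n * n)) (d : R) :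
  (forall lmin : R, is_min_eigenvalue W lmin ->
     lifted_equiv (Intersection_SDP W c d) (DS_program W c d lmin)) /\
  (forall F : 'M[R]_(n * n, (n - 1) ^ 2),
     F^T *m F = 1%:M -> columns_span_ker F (dsA n) ->
     forall lbar : R, is_min_eigenvalue (F^T *m W *m F) lbar ->
     lifted_equiv (P_program W c d) (DS_program W c d lbar)) /\
  ((forall (X : 'M[R]_n) (Y : 'M[R]_(n * n)),
      feasible (SDP_program W c d) (X, Y) <->
      feasible (P_program W c d) (X, Y) /\ [/\ L1 Y, L2 Y & L3 X Y]) /\
   (forall (X : 'M[R]_n) (Y : 'M[R]_(n * n)),
      objective (SDP_program W c d) (X, Y) =
      objective (P_program W c d) (X, Y))).
Proof.
split; [|split; [|split=> //]].
- move=> a amin; apply: lifted_equivI => [X Y [_ trY Xds XY]|X Xds] /=.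
    split=> //; rewrite (lifted_energy_gap _ _ _ a) // lerDl subr_ge0.
    exact: min_eigenvalue_trace_le.
  have [u [u1 Wu]] := eigenvalue_unit_vector hW amin.1.
  have [Ysym trY XY objE] := rank1_lift c d Xds u1 Wu.
  by eexists; split; last exact: objE.
- move=> F FF Fker a amin.
  have FWsym : (F^T *m W *m F)^T = F^T *m W *m F.
    by rewrite !trmx_mul trmxK hW mulmxA.
  apply: lifted_equivI => [X Y /= [[Ysym trY X0] [AX AY XY]]|X Xds] /=.
    have [rowX colX] := (dsAbE X).1 AX; split=> //.
    rewrite (lifted_energy_gap _ _ _ a) // lerDl subr_ge0.
    have [Zsym Zpos] := XY; set Z := Y - _ in Zsym Zpos *.
    have AZ : dsA n *m Z = 0 by rewrite mulmxBr AY mulmxA AX subrr.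
    (* Each column of [Z] lies in the kernel of [A], that is in the range of [F], on which
       [F *m F^T] is the identity. *)
    have FFZ : F *m (F^T *m Z) = Z.
      apply/trmx_inj/row_matrixP => j; rewrite -!tr_col; congr trmx.
      rewrite !colE -!mulmxA; set v := Z *m _.
      have /Fker [w ->] : dsA n *m v = 0 by rewrite mulmxA AZ mul0mx.
      by rewrite [F^T *m _]mulmxA FF mul1mx.
    have ZFF : Z *m F *m F^T = Z.
      by have := congr1 trmx FFZ; rewrite !trmx_mul trmxK Zsym.
    have trZ : \tr Z = \tr (F^T *m Z *m F).
      by rewrite mxtrace_mulC FFZ.
    have trWZ : \tr (W *m Z) = \tr (F^T *m W *m F *m (F^T *m Z *m F)).
      by rewrite -{1}FFZ -{1}ZFF !mulmxA [LHS]mxtrace_mulC !mulmxA.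
    rewrite trZ trWZ; apply: min_eigenvalue_trace_le => //.
    split=> [|v]; first by rewrite !trmx_mul trmxK Zsym mulmxA.
    by have := Zpos (F *m v); rewrite trmx_mul !mulmxA.
  have [w [w1 Ww]] := eigenvalue_unit_vector FWsym amin.1.
  (* [F] preserves norms, so [u = F *m w] is a unit vector, and its [W]-form is that of [w] under
     [F^T *m W *m F]. *)
  have u1 : \tr (F *m w *m (F *m w)^T) = 1.
    by rewrite trmx_mul mulmxA mxtrace_mulC !mulmxA FF mul1mx.
  have Wu : \tr (W *m (F *m w *m (F *m w)^T)) = a.
    by rewrite -Ww trmx_mul !mulmxA mxtrace_mulC !mulmxA.
  have [Ysym trY XY objE] := rank1_lift c d Xds u1 Wu.
  eexists; split; last exact: objE.
  have [rowX colX X0] := Xds.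
  have AX : dsA n *m colstack X = dsb n by apply/dsAbE.
  split; split=> //.
  (* [F *m w] is in the kernel of [A], so the rank-one term of [Y] does not disturb
     [A Y = b x^T]. *)
  have AFw : dsA n *m (F *m w) = 0 by apply/Fker; exists w.
  rewrite mulmxDr -scalemxAr [dsA n *m (F *m w *m _)]mulmxA AFw mul0mx.
  by rewrite scaler0 addr0 mulmxA AX.
- move=> X Y.
  have X0E : mx_nonneg (colstack X) <-> mx_nonneg X.
    split=> X0 i j; first by rewrite -colstackE.
    rewrite ord1; case/mxvec_indexP: i => q r.
    by rewrite -[mxvec_index q r]/(cpos r q) colstackE.
  split=> [[[Ysym trY X0 AX XY] [Y1 Y2 Y3]]
          |[[[Ysym trY X0] [AX AY XY]] Y123]].
    split=> //; split; split=> //; first exact/X0E.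
    exact: L3_dsA_mul.
  by split=> //; split=> //; apply/X0E.
Qed.
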